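(* For real $\vartheta$ and $s\ge 0$ put $\alpha=e^{\vartheta s}\cosh s$, $\beta=e^{\vartheta s}\sinh s$, and consider the quadratic form in the four variables $z_i,z_j,u_i,u_j$ $$\Psi_{\vartheta,s}=u_iu_j+z_iz_j+\alpha(z_iu_j+z_ju_i)+\beta(z_iu_i+z_ju_j),$$ whose Hessian has the four eigenvalues (with multiplicity) $$\mu_1=1+e^{(\vartheta+1)s},\quad \mu_2=1-e^{(\vartheta+1)s},\quad \mu_3=-1-e^{(\vartheta-1)s},\quad \mu_4=e^{(\vartheta-1)s}-1.$$ (a) If $s=0$, then for every $\vartheta\in\mathbb{R}$ the eigenvalues $(\mu_1,\mu_2,\mu_3,\mu_4)$ are $2,0,-2,0$, and the edge heat gate $T_e^{(\vartheta)}(0)$ is the identity. (b) If $s>0$, then the Hessian of $\Psi_{\vartheta,s}$ has at most one positive eigenvalue if and only if $-1\le\vartheta\le1$. At $\vartheta=-1$ one has $\mu_2=0$, and at $\vartheta=1$ one has $\mu_4=0$. If $\vartheta<-1$ then $\mu_1$ and $\mu_2$ are both positive, and if $\vartheta>1$ then $\mu_1$ and $\mu_4$ are both positive. In particular, for $s>0$ and $\vartheta\notin[-1,1]$ the polynomial $\Psi_{\vartheta,s}$ is not Lorentzian.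
   Context: The edge heat gate for $e=\{i,j\}$ is the linear operator $T_e^{(\vartheta)}(s)=e^{sL_e^{(\vartheta)}}$ on the space spanned by $1,z_i,z_j,z_iz_j$, where $L_e^{(\vartheta)}(1)=0$, $L_e^{(\vartheta)}(z_iz_j)=0$, $L_e^{(\vartheta)}(z_i)=\vartheta z_i+z_j$, $L_e^{(\vartheta)}(z_j)=z_i+\vartheta z_j$. The quadratic $\Psi_{\vartheta,s}$ is its operator symbol $u_iu_j\,T(1)+u_j\,T(z_i)+u_i\,T(z_j)+T(z_iz_j)$ with $T=T_e^{(\vartheta)}(s)$. Lorentzian polynomials (in the sense of Brändén and Huh): a homogeneous polynomial $f$ of degree $d$ in $N$ variables with nonnegative real coefficients is Lorentzian if (i) its support $J\subseteq\mathbb{N}^N$ (the set of exponents of monomials with nonzero coefficient) is M-convex, meaning that for all $\alpha,\beta\in J$ and every index $i$ with $\alpha_i>\beta_i$ there is an index $j$ with $\alpha_j<\beta_j$ and $\alpha-e_i+e_j\in J$ ($e_i$ the standard unit vectors); and (ii) if $d\ge2$, for every sequence of indices $i_1,\dots,i_{d-2}$ the Hessian matrix of the quadratic form $\partial_{i_1}\cdots\partial_{i_{d-2}}f$ has at most one positive eigenvalue (counted with multiplicity). For a quadratic form ($d=2$), condition (ii) says that its own Hessian has at most one positive eigenvalue. *)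

(* Defs.v *)
(* MathComp, with MathComp-Analysis for the reals. *)
From HB Require Import structures.
From mathcomp Require Import all_boot all_order all_algebra.
From mathcomp Require Import polyrcf.
From mathcomp Require Import all_classical all_reals all_analysis.
(* The notations of mpoly clash with those of mathcomp-analysis. *)
From mathcomp Require Import -(notations) mpoly.
Set Implicit Arguments.
Unset Strict Implicit.
Unset Printing Implicit Defensive.
Import Order.TTheory GRing.Theory Num.Theory.
Import numFieldNormedType.Exports.
Local Open Scope classical_set_scope.
Local Open Scope ring_scope.

Notation "{ 'mpoly' T [ n ] }" := (mpoly n T) : type_scope.

Definition coshR (R : realType) (x : R) : R := (expR x + expR (- x)) / 2.
Definition sinhR (R : realType) (x : R) : R := (expR x - expR (- x)) / 2.

Definition expmx (R : realType) (n : nat) (A : 'M[R]_n.+1) : 'M[R]_n.+1 :=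
  limn (series (fun k : nat => k`!%:R^-1 *: A ^+ k)).

(* Eigenvalues are counted with their multiplicity as roots of the
   characteristic polynomial. *)
Definition num_pos_eigenvalues (R : realType) (n : nat) (A : 'M[R]_n) : nat :=
  (\sum_(x <- rootsR (char_poly A) | (0 < x)%R) mup x (char_poly A))%N.

(* Only used for quadratic forms, whose second derivatives are constant: the
   constant coefficient is then the whole second derivative. *)
Definition hessian (R : realType) (n : nat) (f : {mpoly R[n]}) : 'M[R]_n :=
  \matrix_(i, j) mcoeff mnm0 (mderiv j (mderiv i f)).

(* [mnm_sub] is truncated, but here it only subtracts 1 from [a i > 0]. *)
Definition M_convex (n : nat) (J : pred (multinom n)) : Prop :=
  forall a b : multinom n, J a -> J b ->
  forall i : 'I_n, (b i < a i)%N ->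
  exists2 j : 'I_n, (a j < b j)%N & J (mnm_add (mnm_sub a (mnm1 i)) (mnm1 j)).

Definition lorentzian_deg (R : realType) (n d : nat) (f : {mpoly R[n]}) : Prop :=
  [/\ f \is ishomog1 d mdeg,
      forall m : multinom n, 0 <= mcoeff m f,
      M_convex (fun m => mcoeff m f != 0)
    & (2 <= d)%N -> forall t : (d - 2).-tuple 'I_n,
        (num_pos_eigenvalues (hessian (foldr (@mderiv n R) f t)) <= 1)%N].

Definition lorentzian (R : realType) (n : nat) (f : {mpoly R[n]}) : Prop :=
  exists d : nat, lorentzian_deg d f.

(* The four variables z_i, z_j, u_i, u_j attached to an edge e = {i, j}. *)
Definition zi (R : realType) : {mpoly R[4]} := mpolyX R (mnm1 (@Ordinal 4 0 isT)).
Definition zj (R : realType) : {mpoly R[4]} := mpolyX R (mnm1 (@Ordinal 4 1 isT)).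
Definition ui (R : realType) : {mpoly R[4]} := mpolyX R (mnm1 (@Ordinal 4 2 isT)).
Definition uj (R : realType) : {mpoly R[4]} := mpolyX R (mnm1 (@Ordinal 4 3 isT)).

(* Linear operators on span(1, z_i, z_j, z_i z_j) are 4 x 4 matrices in this
   basis: row k of the matrix holds the coordinates of the image of the k-th
   basis element. *)
Definition edge_basis (R : realType) (k : 'I_4) : {mpoly R[4]} :=
  nth 0 [:: 1; zi R; zj R; zi R * zj R] k.

Definition edge_generator (R : realType) (theta : R) : 'M[R]_4 :=
  \matrix_(k, l)
    nth 0 (nth [::] [:: [:: 0; 0;     0;     0];
                        [:: 0; theta; 1;     0];
                        [:: 0; 1;     theta; 0];
                        [:: 0; 0;     0;     0]] k) l.

Definition edge_heat_gate (R : realType) (theta s : R) : 'M[R]_4 :=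
  expmx (s *: edge_generator theta).

Definition image_of_basis (R : realType) (T : 'M[R]_4) (k : 'I_4) :
    {mpoly R[4]} :=
  \sum_(l < 4) T k l *: edge_basis R l.

Definition edge_symbol (R : realType) (T : 'M[R]_4) : {mpoly R[4]} :=
  ui R * uj R * image_of_basis T (@Ordinal 4 0 isT)
  + uj R * image_of_basis T (@Ordinal 4 1 isT)
  + ui R * image_of_basis T (@Ordinal 4 2 isT)
  + image_of_basis T (@Ordinal 4 3 isT).

Definition Psi (R : realType) (theta s : R) : {mpoly R[4]} :=
  let alpha := expR (theta * s) * coshR s in
  let beta := expR (theta * s) * sinhR s in
  ui R * uj R + zi R * zj R
  + alpha *: (zi R * uj R + zj R * ui R)
  + beta *: (zi R * ui R + zj R * uj R).

Definition mu1 (R : realType) (theta s : R) : R := 1 + expR ((theta + 1) * s).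
Definition mu2 (R : realType) (theta s : R) : R := 1 - expR ((theta + 1) * s).
Definition mu3 (R : realType) (theta s : R) : R := -1 - expR ((theta - 1) * s).
Definition mu4 (R : realType) (theta s : R) : R := expR ((theta - 1) * s) - 1.

(* Main.v *)
Require Import Defs.
From HB Require Import structures.
From mathcomp Require Import all_boot all_order all_algebra.
From mathcomp Require Import polyrcf.
From mathcomp Require Import all_classical all_reals all_analysis.
From mathcomp Require Import -(notations) mpoly.
From mathcomp Require Import ring.
Import Order.TTheory GRing.Theory Num.Theory.
Import numFieldNormedType.Exports.
Local Open Scope ring_scope.

(** The Hessian of Psi is invariant under the Klein four-group permuting
    z_i, z_j, u_i, u_j, so the character table of that group diagonalises it;
    the signs of mu_2 and mu_4 are those of -1 - theta and theta - 1, while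
    mu_1 > 0 > mu_3.  The generator of the gate has the spectral idempotents of
    the eigenvalues 0, theta + 1 and theta - 1, which turns its exponential
    series into three scalar ones. *)

(** Over polynomials the intertwining reads P (X - A) = (X - B) P; determinants give the claim once
    det P, a nonzero constant, is cancelled. *)
Lemma char_poly_similar (F : fieldType) (n : nat) (P A B : 'M[F]_n) :
  P \in unitmx -> P *m A = B *m P -> char_poly A = char_poly B.
Proof.
move=> Pu PA.
have Pd : \det (map_mx polyC P) != 0.
  by rewrite det_map_mx polyC_eq0 -unitfE -unitmxE.
apply: (mulfI Pd); rewrite [RHS]mulrC -!det_mulmx; congr (\det _).
rewrite /char_poly_mx mulmxBr mulmxBl -!map_mxM PA; congr (_ - _).
by rewrite mul_mx_scalar mul_scalar_mx.
Qed.

Lemma num_pos_eigenvalues_split (R : realType) (n : nat) (A : 'M[R]_n)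
    (mus : seq R) :
  char_poly A = \prod_(mu <- mus) ('X - mu%:P) ->
  num_pos_eigenvalues A = count (fun mu => 0 < mu) mus.
Proof.
move=> charA; rewrite /num_pos_eigenvalues charA.
have p_neq0 : \prod_(mu <- mus) ('X - mu%:P) != 0.
  exact: monic_neq0 (monic_prod_XsubC _ _ _).
have root_uniq : uniq (rootsR (\prod_(mu <- mus) ('X - mu%:P))).
  exact: uniq_roots.
have mem_root y : (y \in rootsR (\prod_(mu <- mus) ('X - mu%:P))) = (y \in mus).
  have := roots_on_rootsR p_neq0 y.
  by rewrite in_itv /= root_prod_XsubC => ->.
(* The multiplicity of x in the product is the number of occurrences of x in [mus]; the double sum
   over roots and entries can then be exchanged. *)
under eq_bigr do rewrite mu_prod_XsubC -sum1_count.
rewrite (exchange_big_dep (fun y => 0 < y)) /=; last by move=> x y x_gt0 /eqP ->.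
rewrite -sum1_count big_seq_cond [RHS]big_seq_cond.
apply: eq_bigr => y /andP[y_mus y_gt0].
(* Only the root x = y contributes, and it occurs exactly once in the duplicate-free list of
   roots. *)
rewrite (eq_bigl (pred1 y)); last first.
  by move=> x /=; rewrite eq_sym; case: eqP => [->|]; rewrite ?y_gt0 ?andbF.
by rewrite sum1_count count_uniq_mem // mem_root y_mus.
Qed.

(** Multiplying A^k by 1 = sum of the E i gives A^k = sum of lam_i^k E i, so each partial sum of the
    matrix series is a combination of scalar exponential partial sums. *)
Lemma expmx_spectral (R : realType) (n m : nat) (A : 'M[R]_n.+1)
    (lam : 'I_m -> R) (E : 'I_m -> 'M[R]_n.+1) :
  \sum_i E i = 1 -> (forall i, A * E i = lam i *: E i) ->
  expmx A = \sum_i expR (lam i) *: E i.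
Proof.
move=> sumE eigE.
have powE k i : A ^+ k * E i = lam i ^+ k *: E i.
  elim: k => [|k IHk]; first by rewrite !expr0 mul1r scale1r.
  by rewrite exprSr -mulrA eigE -scalerAr IHk scalerA -exprS.
have serE : series (fun k : nat => k`!%:R^-1 *: A ^+ k) =
    (fun N : nat => \sum_i series (exp_coeff (lam i)) N *: E i).
  apply/funext => N; rewrite /series /=.
  under [RHS]eq_bigr do rewrite scaler_suml.
  rewrite exchange_big; apply: eq_bigr => k _ /=.
  rewrite -[A ^+ k]mulr1 -sumE mulr_sumr scaler_sumr.
  by apply: eq_bigr => i _; rewrite powE scalerA mulrC.
rewrite /expmx serE; apply: cvg_lim => //.
apply: cvg_big => [|i _]; first exact: add_continuous.
by apply: cvgZl; exact: is_cvg_series_exp_coeff.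
Qed.

Definition mx4 {R : nzRingType} (rows : seq (seq R)) : 'M[R]_4 :=
  \matrix_(i, j) nth 0 (nth [::] rows i) j.

Definition alpha {R : realType} (theta s : R) : R := expR (theta * s) * coshR s.
Definition beta {R : realType} (theta s : R) : R := expR (theta * s) * sinhR s.

(** In this form the later matrix identities are polynomial in two exponentials, within reach of
    [ring] and [field]. *)
Lemma alphaE (R : realType) (theta s : R) :
  alpha theta s = (expR ((theta + 1) * s) + expR ((theta - 1) * s)) / 2.
Proof.
rewrite /alpha /coshR [(theta + 1) * s]mulrDl [(theta - 1) * s]mulrBl mul1r.
by rewrite !expRD; ring.
Qed.

Lemma betaE (R : realType) (theta s : R) :
  beta theta s = (expR ((theta + 1) * s) - expR ((theta - 1) * s)) / 2.
Proof.
rewrite /beta /sinhR [(theta + 1) * s]mulrDl [(theta - 1) * s]mulrBl mul1r.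
by rewrite !expRD; ring.
Qed.

Lemma edge_heat_gateE (R : realType) (theta s : R) (a := alpha theta s)
    (b := beta theta s) :
  edge_heat_gate theta s =
  mx4 [:: [:: 1; 0; 0; 0]; [:: 0; a; b; 0]; [:: 0; b; a; 0]; [:: 0; 0; 0; 1]].
Proof.
pose h : R := 2^-1.
pose lam (i : 'I_3) : R := nth 0 [:: 0; (theta + 1) * s; (theta - 1) * s] i.
(* Projections onto the span of 1 and z_i z_j, onto the line of z_i + z_j, and onto the line of z_i
   - z_j. *)
pose E (i : 'I_3) : 'M[R]_4 := mx4 (nth [::]
  [:: [:: [:: 1; 0; 0; 0]; [:: 0; 0; 0; 0]; [:: 0; 0; 0; 0]; [:: 0; 0; 0; 1]];
      [:: [:: 0; 0; 0; 0]; [:: 0; h; h; 0]; [:: 0; h; h; 0]; [:: 0; 0; 0; 0]];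
      [:: [:: 0; 0; 0; 0]; [:: 0; h; -h; 0]; [:: 0; -h; h; 0];
          [:: 0; 0; 0; 0]]] i).
rewrite /edge_heat_gate (@expmx_spectral _ _ _ _ lam E).
- rewrite !big_ord_recl big_ord0 /E /lam /= expR0 /a /b alphaE betaE /h.
  apply/matrixP; do 2 (case=> [[|[|[|[|//]]]] ?]); rewrite !mxE /=; ring.
- rewrite !big_ord_recl big_ord0 /E /= /h.
  apply/matrixP; do 2 (case=> [[|[|[|[|//]]]] ?]); rewrite !mxE /=; by field.
- case=> [[|[|[|k]]] lt_k3] //; rewrite /E /lam /=;
  apply/matrixP; do 2 (case=> [[|[|[|[|//]]]] ?]);
  rewrite !mxE !big_ord_recl big_ord0 !mxE /= /h; by field.
Qed.

Lemma edge_symbol_heat_gate (R : realType) (theta s : R) :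
  edge_symbol (edge_heat_gate theta s) = Psi theta s.
Proof.
rewrite edge_heat_gateE /edge_symbol /image_of_basis /edge_basis.
rewrite !big_ord_recl !big_ord0 !mxE /= /Psi.
rewrite -/(alpha theta s) -/(beta theta s) !scale0r !scale1r -!mul_mpolyC.
ring.
Qed.

Lemma mderivXU (R : nzRingType) (n : nat) (i j : 'I_n) :
  mderiv i (mpolyX R (mnm1 j)) = (i == j)%:R.
Proof.
rewrite mderivX mnm1E eq_sym; case: eqP => [->|_]; last by rewrite scale0r.
rewrite scale1r -[RHS](mpolyX0 n R); congr mpolyX.
by apply/mnmP => k; rewrite mnmBE mnm0E subnn.
Qed.

Lemma hessian_is_linear (R : realType) (n : nat) : linear (@hessian R n).
Proof.
by move=> c p q; apply/matrixP => i j; rewrite !mxE !linearP.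
Qed.

HB.instance Definition _ (R : realType) (n : nat) :=
  GRing.isLinear.Build R (mpoly n R) 'M[R]_n *:%R (@hessian R n)
    (@hessian_is_linear R n).

Lemma hessianXX (R : realType) (n : nat) (i j : 'I_n) :
  hessian (mpolyX R (mnm1 i) * mpolyX R (mnm1 j)) =
  delta_mx i j + delta_mx j i.
Proof.
apply/matrixP => k l; rewrite !mxE mderivM !mderivXU raddfD /= !mderivM !mderivXU.
(* First derivatives of the variables are Kronecker deltas, hence constants, so only the mixed terms
   of the product rule survive. *)
have mderiv_nat (m : nat) : mderiv l (m%:R : mpoly n R) = 0.
  by rewrite mderivMn -mpolyC1 mderivC mul0rn.
rewrite !mderiv_nat mul0r add0r mulr0 addr0 -!natrM -natrD.
rewrite mcoeffMn mcoeff1 eqxx natrD !mulnb.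
by rewrite [(l == i) && _]andbC.
Qed.

Lemma hessian_Psi (R : realType) (theta s : R) (a := alpha theta s)
    (b := beta theta s) :
  hessian (Psi theta s) =
  mx4 [:: [:: 0; 1; b; a]; [:: 1; 0; a; b]; [:: b; a; 0; 1]; [:: a; b; 1; 0]].
Proof.
rewrite /Psi -/(alpha theta s) -/(beta theta s) !(linearD, linearZ) /=.
rewrite /zi /zj /ui /uj !hessianXX.
apply/matrixP; do 2 (case=> [[|[|[|[|//]]]] ?]); rewrite !mxE /= /a /b; ring.
Qed.

Lemma char_poly_hessian_Psi (R : realType) (theta s : R) :
  char_poly (hessian (Psi theta s)) =
  \prod_(mu <- [:: mu1 theta s; mu2 theta s; mu3 theta s; mu4 theta s])
    ('X - mu%:P).
Proof.
(* The character table is symmetric with P^2 = 4, and its rows are eigenvectors of the Hessian in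
   the order of [mus]. *)
pose P : 'M[R]_4 := mx4 [:: [:: 1; 1; 1; 1]; [:: 1; 1; -1; -1];
                            [:: 1; -1; 1; -1]; [:: 1; -1; -1; 1]].
pose mus := [:: mu1 theta s; mu2 theta s; mu3 theta s; mu4 theta s].
pose d : 'rV[R]_4 := \row_j nth 0 mus j.
have PP : P *m (4^-1 *: P) = 1%:M.
  apply/matrixP; do 2 (case=> [[|[|[|[|//]]]] ?]);
  rewrite !mxE !big_ord_recl big_ord0 !mxE /=; by field.
have Pu : P \in unitmx by have [] := mulmx1_unit PP.
rewrite (@char_poly_similar _ _ P _ (diag_mx d) Pu); last first.
  rewrite hessian_Psi alphaE betaE mul_diag_mx.
  apply/matrixP; do 2 (case=> [[|[|[|[|//]]]] ?]);
  rewrite !mxE !big_ord_recl big_ord0 !mxE /= /mu1 /mu2 /mu3 /mu4; by field.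
rewrite (char_poly_trig (diag_mx_is_trig d)).
by rewrite !big_ord_recl big_ord0 !big_cons big_nil !mxE.
Qed.

Lemma dhomog_Psi (R : realType) (theta s : R) :
  Psi theta s \is ishomog1 2 mdeg.
Proof.
have XX (i j : 'I_4) :
    mpolyX R (mnm1 i) * mpolyX R (mnm1 j) \is ishomog1 2 mdeg.
  (* The degree 2 arises as 1 + 1, one from each variable. *)
  by apply: (@dhomogM _ _ _ 1 _ 1); rewrite dhomogX /= mdeg1.
by do ![apply: dhomogD | apply: dhomogZ | exact: XX].
Qed.

(** A nonzero polynomial has only one degree of homogeneity, so the degree in [lorentzian] must be
    2, and the empty tuple of derivatives gives the condition on [Psi] itself. *)
Lemma lorentzian_Psi_num_pos_eigenvalues (R : realType) (theta s : R) :
  lorentzian (Psi theta s) ->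
  (num_pos_eigenvalues (hessian (Psi theta s)) <= 1)%N.
Proof.
case=> d [homd _ _ hess].
have Psi_neq0 : Psi theta s != 0.
  apply/eqP => /(congr1 (@hessian R 4)); rewrite hessian_Psi linear0.
  (* The entry read off is the coefficient 1 of z_i z_j. *)
  by move=> /matrixP /(_ 0 1) /eqP; rewrite !mxE /= oner_eq0.
have d2 := dhomog_uniq Psi_neq0 homd (dhomog_Psi R theta s).
by subst d; exact: (hess isT [tuple]).
Qed.

Section Eigenvalue_signs.
Context {R : realType} {theta s : R}.
Hypothesis s_gt0 : 0 < s.

Lemma mu1_gt0 : 0 < mu1 theta s.
Proof. by rewrite addr_gt0 ?expR_gt0. Qed.

Lemma mu3_lt0 : mu3 theta s < 0.
Proof. by rewrite /mu3 -opprD oppr_lt0 addr_gt0 ?expR_gt0. Qed.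

Lemma mu2_gt0 : (0 < mu2 theta s) = (theta < -1).
Proof.
by rewrite subr_gt0 expR_lt1 pmulr_llt0 // -ltrBrDr sub0r.
Qed.

Lemma mu4_gt0 : (0 < mu4 theta s) = (1 < theta).
Proof. by rewrite subr_gt0 expR_gt1 pmulr_lgt0 // subr_gt0. Qed.

Lemma num_pos_eigenvalues_hessian_Psi :
  (num_pos_eigenvalues (hessian (Psi theta s)) <= 1)%N = (-1 <= theta <= 1).
Proof.
rewrite (num_pos_eigenvalues_split _ _ _ _ (char_poly_hessian_Psi R theta s)) /=.
(* [mu1] always counts once and [mu3] never, so the bound says that neither [mu2] nor [mu4] is
   positive. *)
rewrite mu1_gt0 mu2_gt0 mu4_gt0 (lt_gtF mu3_lt0) addn0 /= add1n ltnS leqn0.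
by rewrite addn_eq0 !eqb0 -!leNgt.
Qed.

End Eigenvalue_signs.

Theorem mainTheorem5 (R : realType) (theta s : R) (s_ge0 : 0 <= s) :
  (* Psi is the symbol of the gate; spectrum of its Hessian *)
  edge_symbol (edge_heat_gate theta s) = Psi theta s /\
  char_poly (hessian (Psi theta s)) =
    \prod_(mu <- [:: mu1 theta s; mu2 theta s; mu3 theta s; mu4 theta s])
      ('X - mu%:P) /\
  (* (a) *)
  (s = 0 ->
    [/\ mu1 theta s = 2, mu2 theta s = 0, mu3 theta s = - 2, mu4 theta s = 0
      & edge_heat_gate theta s = 1%:M]) /\
  (* (b) *)
  (0 < s ->
    ((num_pos_eigenvalues (hessian (Psi theta s)) <= 1)%N <-> -1 <= theta <= 1) /\
    (theta = -1 -> mu2 theta s = 0) /\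
    (theta = 1 -> mu4 theta s = 0) /\
    (theta < -1 -> 0 < mu1 theta s /\ 0 < mu2 theta s) /\
    (1 < theta -> 0 < mu1 theta s /\ 0 < mu4 theta s) /\
    (~ (-1 <= theta <= 1) -> ~ lorentzian (Psi theta s))).
Proof.
split; first exact: edge_symbol_heat_gate.
split; first exact: char_poly_hessian_Psi.
split=> [->|s_gt0].
  rewrite /mu1 /mu2 /mu3 /mu4 !mulr0 expR0; split; try ring.
  (* At s = 0 the closed form of the gate has [alpha] = 1 and [beta] = 0. *)
  rewrite edge_heat_gateE alphaE betaE !mulr0 expR0.
  by apply/matrixP; do 2 (case=> [[|[|[|[|//]]]] ?]); rewrite !mxE /=; by field.
(* The equivalence becomes reflexive, and the signs of [mu2] and [mu4] become the inequalities on
   [theta] themselves. *)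
rewrite (num_pos_eigenvalues_hessian_Psi s_gt0) (mu2_gt0 s_gt0) (mu4_gt0 s_gt0).
split=> //; split=> [->|].
  by rewrite /mu2 addNr mul0r expR0 subrr.
split=> [->|].
  by rewrite /mu4 subrr mul0r expR0 subrr.
split=> [lt_theta|]; first by split=> //; exact: mu1_gt0.
split=> [lt_theta|]; first by split=> //; exact: mu1_gt0.
move=> theta_out /lorentzian_Psi_num_pos_eigenvalues.
by rewrite (num_pos_eigenvalues_hessian_Psi s_gt0).
Qed.
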